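(* Let $f:\mathbb{R}\to\mathbb{R}$ be an $n$-times differentiable function. Let $\lambda_1,\dots,\lambda_k\in\mathbb{R}$ be distinct, let $m_1,\dots,m_k$ be positive integers with $\sum_{j=1}^k m_j=n$, and let $L$ be the Lagrange interpolation polynomial of $f$ with interpolation points $\lambda_1,\dots,\lambda_k$ and multiplicities $m_1,\dots,m_k$. Then for $x_0\in\mathbb{R}$ there exists $\xi$ inside the convex hull $U$ formed by the interpolation points $\lambda_1,\dots,\lambda_k$ such that $$f(x_0)-L(x_0)=\frac{f^{(n)}(\xi)}{n!}(x_0-\lambda_1)^{m_1}\cdots(x_0-\lambda_k)^{m_k}.$$
   Context: The Lagrange interpolation polynomial of $f$ with interpolation points $\lambda_1,\dots,\lambda_k$ and multiplicities $m_1,\dots,m_k$ is the unique polynomial $L$ of degree less than $n=m_1+\dots+m_k$ such that $L^{(m)}(\lambda_j)=f^{(m)}(\lambda_j)$ for all $1\le j\le k$ and $0\le m<m_j$, where $g^{(0)}=g$ and $g^{(m)}$ denotes the $m$-th derivative of $g$ for $m>0$.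
   Formalization: ξ is taken in the convex hull of the interpolation points together with x_0, since the claim with the hull of the interpolation points alone fails (f=x², single simple node 0, x_0=1); when x_0 already lies in U the two hulls coincide. *)

(* Defs.v *)
From HB Require Import structures.
From mathcomp Require Import all_boot all_order all_algebra.
From mathcomp Require Import all_classical all_reals all_analysis.
Set Implicit Arguments.
Unset Strict Implicit.
Unset Printing Implicit Defensive.
Import Order.TTheory GRing.Theory Num.Theory.
Import numFieldNormedType.Exports.
Local Open Scope classical_set_scope.
Local Open Scope ring_scope.

(* [f^`(n)] itself need not be continuous, nor differentiable. *)
Definition n_times_differentiable (R : realType) (n : nat) (f : R -> R) : Prop :=
  forall (i : nat) (x : R), (i < n)%N -> derivable (f^`(i)%classic) x 1.

(* [size L] is [deg L + 1], so the first clause reads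
   [deg L < m_1 + ... + m_k]. *)
Definition lagrange_interpolation (R : realType) (f : R -> R) (k : nat)
    (lambda : 'I_k -> R) (m : 'I_k -> nat) (L : {poly R}) : Prop :=
  (size L <= \sum_(j < k) m j)%N /\
  forall (j : 'I_k) (i : nat), (i < m j)%N ->
    (fun x => L.[x])^`(i)%classic (lambda j) = f^`(i)%classic (lambda j).

Definition convex_hull (R : realType) (A : set R) : set R :=
  smallest [set C : set R | convex_set (C : set (convex_lmodType R^o))] A.

(* The point of evaluation must be allowed in the hull containing the mean
   value point: for [f = x^2] and the single simple node [0], [L = 0], and
   [x0^2 = f^`() xi * x0] forces [xi = x0 / 2] when [x0 != 0], whereas the hull
   of the nodes is [[set 0]].  By the next lemma, adding [x0] changes nothing
   when it already lies in the hull of the nodes. *)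
Lemma convex_hullU1 (R : realType) (A : set R) (x0 : R) :
  convex_hull A x0 -> convex_hull (x0 |` A) = convex_hull A.
Proof.
move=> Ax0; apply/seteqP; split => x hx C [/= convC subC]; apply: hx.
- by split=> //= y [->|/subC//]; apply: Ax0.
- by split=> //= y Ay; apply: subC; right.
Qed.

(* Main.v *)
Require Import Defs.
From HB Require Import structures.
From mathcomp Require Import all_boot all_order all_algebra.
From mathcomp Require Import all_classical all_reals all_analysis.
From mathcomp Require Import ring lra.
Set Implicit Arguments.
Unset Strict Implicit.
Unset Printing Implicit Defensive.
Import Order.TTheory GRing.Theory Num.Theory.
Import numFieldNormedType.Exports.
Local Open Scope classical_set_scope.
Local Open Scope ring_scope.

(** The theorem is the Cauchy form of the Hermite interpolation error.  Let
    [w] be the monic polynomial of degree [n] with a zero of order [m j] at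
    each [lambda j].  If [x0] is a node, both sides of the formula are zero and
    any [xi] in the hull will do.  Otherwise [w.[x0] != 0], and with
    [c = (f x0 - L.[x0]) / w.[x0]] the function [g = f - (L + c *: w)] vanishes
    at [x0] and, to order [m j], at every [lambda j]: it has [n + 1] zeros
    counted with multiplicity.  A zero [xi] of the [n]-th derivative of [g]
    between two of them gives the formula, because the [n]-th derivative of
    [L + c *: w] is the constant [c * n!].

    The zero [xi] comes from the generalized Rolle theorem
    [Rolle_multiplicity].  Its form is what keeps the induction short: the
    zeros are a nondecreasing sequence [t 0 <= ... <= t n] with repetitions, and
    multiplicity is expressed by requiring that the [d]-th derivative vanish at
    [t p] whenever [t p = t (p + d)].  This condition passes to the derivative
    with one point [u p] chosen in each gap, strictly inside it unless the gap
    is a single point.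

    The nodes and [x0] are brought to this form by sorting the list in which
    each node is repeated according to its multiplicity: [sorted_count_run]
    turns an equality [t p = t (p + d)] into [d] being less than the
    multiplicity. *)

(** * Convex hulls on the line *)

Lemma convex_hull_segment (R : realType) (A : set R) (a b x : R) :
  A a -> A b -> a <= x <= b -> convex_hull A x.
Proof.
move=> Aa Ab /andP[ax xb] C [/= convC subC].
have [ab|ba] := ltP a b; last first.
  have -> : x = a by lra.
  exact: subC.
have ba0 : 0 < b - a by rewrite subr_gt0.
have t0 : 0 <= (b - x) / (b - a) by rewrite divr_ge0// ?subr_ge0// ltW.
have t1 : (b - x) / (b - a) <= 1 by rewrite ler_pdivrMr// mul1r lerB.
have := convC a b (Itv01 t0 t1) (mem_set (subC _ Aa)) (mem_set (subC _ Ab)).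
rewrite inE => Ct.
have <- : (b - x) / (b - a) * a + (1 - (b - x) / (b - a)) * b = x.
  by field; rewrite gt_eqF.
exact: Ct.
Qed.

(** * Rolle's theorem for zeros with multiplicity *)

Lemma le_chain (R : realType) (n : nat) (t : nat -> R) :
  (forall p, (p < n)%N -> t p <= t p.+1) ->
  forall p q, (p <= q)%N -> (q <= n)%N -> t p <= t q.
Proof.
move=> tS p; elim=> [|q IHq]; first by rewrite leqn0 => /eqP->.
rewrite leq_eqVlt => /predU1P[->//|]; rewrite ltnS => pq qn.
exact: le_trans (IHq pq (ltnW qn)) (tS _ qn).
Qed.

Lemma n_times_differentiableS (R : realType) (n : nat) (f : R -> R) :
  n_times_differentiable n.+1 f <->
  (forall x, derivable f x 1) /\ n_times_differentiable n f^`()%classic.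
Proof.
split=> [df|[df0 df] [|i] x]; last 2 first.
- by move=> _; exact: df0.
- by rewrite ltnS derive1Sn => /df.
split=> [x|i x lin]; first exact: (df 0%N x).
by rewrite -derive1Sn; exact: df.
Qed.

(** The induction step of [Rolle_multiplicity] on one gap: a proper gap gets a
    point of its interior, a degenerate one keeps its end point, which is a
    double zero.  The strictness of the inclusion is what later separates a
    Rolle point from the repeated zeros next to it. *)
Lemma Rolle_zeros (R : realType) (g : R -> R) (a b : R) :
  (forall x, derivable g x 1) -> a <= b -> g a = 0 -> g b = 0 ->
  (a = b -> g^`()%classic a = 0) ->
  exists c, [/\ a <= c <= b, a < b -> a < c < b & g^`()%classic c = 0].
Proof.
move=> dg; rewrite le_eqVlt => /predU1P[<- _ _ /(_ erefl) ga|ab ga gb _].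
  by exists a; split; rewrite ?lexx ?ltxx.
have [||c] := Rolle ab (fun x _ => dg x).
- by apply: derivable_within_continuous => x _; exact: dg.
- by rewrite ga gb.
rewrite in_itv/= => cab /@derive_val g'c.
by exists c; split; [case/andP: cab => ? ?; rewrite !ltW| |rewrite derive1E].
Qed.

(** Let [u p] be the zero of [g'] in the gap from [t p] to [t p.+1].  When
    [u p = u (p + d)] with [d > 0], everything between these two points
    collapses to one value, including [t p.+1] and [t (p + d)]; so neither of
    the two gaps is proper, and [t p = t (p + d).+1].  Thus a run of
    [d + 1] equal points of [u] comes from a run of [d + 2] equal zeros of [g],
    where the [d]-th derivative of [g'] vanishes. *)
Lemma Rolle_multiplicity (R : realType) (n : nat) (g : R -> R) (t : nat -> R) :
  n_times_differentiable n g ->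
  (forall p, (p < n)%N -> t p <= t p.+1) ->
  (forall p d, (p + d <= n)%N -> t p = t (p + d)%N -> g^`(d)%classic (t p) = 0) ->
  exists xi, t 0%N <= xi <= t n /\ g^`(n)%classic xi = 0.
Proof.
elim: n g t => [|n IHn] g t dg tS g0.
  by exists (t 0%N); rewrite lexx; split => //; exact: (g0 0%N 0%N).
have [dg0 dg'] := (n_times_differentiableS n g).1 dg.
have /choice[u uP] p : exists c, (p <= n)%N ->
    [/\ t p <= c <= t p.+1, t p < t p.+1 -> t p < c < t p.+1 & g^`()%classic c = 0].
  have [pn|np] := leqP p n; last by exists 0.
  have [||||c cP] := @Rolle_zeros R g (t p) (t p.+1) dg0; last by exists c.
  - exact: tS.
  - by apply: (g0 p 0%N); rewrite addn0//= leqW.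
  - by apply: (g0 p.+1 0%N); rewrite addn0.
  - by move=> tp; apply: (g0 p 1%N); rewrite addn1.
have uS p : (p < n)%N -> u p <= u p.+1.
  move=> pn; have [/andP[_ up] _ _] := uP p (ltnW pn).
  by have [/andP[up1 _] _ _] := uP p.+1 pn; exact: le_trans up1.
have [|xi [/andP[u0xi xiun] g'xi]] := IHn g^`()%classic u dg' uS; last first.
  exists xi; rewrite derive1Sn; split=> //.
  have [/andP[t0u0 _] _ _] := uP 0%N isT.
  have [/andP[_ untn] _ _] := uP n (leqnn n).
  by rewrite (le_trans t0u0)// (le_trans xiun).
move=> p [|d] pdn upd; first by have [] := uP p; rewrite // -(addn0 p).
rewrite -derive1Sn; have pn : (p <= n)%N by exact: leq_trans (leq_addr _ _) pdn.
have [/andP[tu ut] strp _] := uP p pn.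
have [/andP[tu' ut'] strq _] := uP (p + d.+1)%N pdn.
have tt : t p.+1 <= t (p + d.+1)%N.
  by apply: (le_chain tS); [rewrite addnS ltnS leq_addr|exact: leqW].
have tpp : t p = t p.+1.
  apply/eqP; rewrite eq_le tS//= leNgt; apply/negP => /strp.
  lra.
have tqq : t (p + d.+1)%N = t (p + d.+1).+1%N.
  apply/eqP; rewrite eq_le tS//= leNgt; apply/negP => /strq.
  lra.
(* The gaps at [p] and at [p + d.+1] are both degenerate, and [u] takes the
   same value in them, so the run of equal zeros of [g] is one longer. *)
have -> : u p = t p by lra.
apply: g0; rewrite addnS ?ltnS// -tqq.
lra.
Qed.

(** * Derivatives of polynomials *)

Lemma derive1n_horner (R : realFieldType) (p : {poly R}) (i : nat) :
  (horner p)^`(i)%classic = horner p^`(i).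
Proof. by elim: i => [//|i IHi]; rewrite derive1nS IHi derivnS derivE. Qed.

Lemma derive1n_sub_poly (R : realType) (n : nat) (f : R -> R) (p : {poly R}) :
  n_times_differentiable n f -> forall i, (i <= n)%N ->
  (fun x => f x - p.[x])^`(i)%classic = (fun x => f^`(i)%classic x - p^`(i).[x]).
Proof.
move=> df; elim=> [_|i IHi lin]; first by rewrite derivn0.
rewrite derive1nS (IHi (ltnW lin)); apply/funext => x.
rewrite derive1nS derivnS derivE !derive1E.
by rewrite deriveB//; exact: df.
Qed.

Lemma n_times_differentiable_sub_poly (R : realType) (n : nat) (f : R -> R)
    (p : {poly R}) :
  n_times_differentiable n f -> n_times_differentiable n (fun x => f x - p.[x]).
Proof.
move=> df i x lin; rewrite (derive1n_sub_poly _ df) ?(ltnW lin)//.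
by apply: derivableB; [exact: df|exact: derivable_horner].
Qed.

(** Deriving once lowers the order of the zero by at most one and leaves a
    polynomial of the same shape, which is why the cofactor [p] is arbitrary:
    it changes at each step of the induction on [i]. *)
Lemma derivn_root_exp (R : comNzRingType) (p : {poly R}) (a : R) (i m : nat) :
  (i < m)%N -> (p * ('X - a%:P) ^+ m)^`(i).[a] = 0.
Proof.
elim: i m p => [|i IHi] [|m] p // im.
  by rewrite derivn0 exprSr mulrA hornerM hornerXsubC subrr mulr0.
rewrite derivSn (_ : _^`() = (p^`() * ('X - a%:P) + p *+ m.+1) * ('X - a%:P) ^+ m).
  exact: IHi.
by rewrite derivM deriv_exp derivXsubC mul1r /= mulrDl exprS mulrA mulrnAr mulrnAl.
Qed.

Lemma derivn_monic (R : nzRingType) (n : nat) (p : {poly R}) :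
  p \is monic -> size p = n.+1 -> p^`(n) = (n`!)%:R%:P.
Proof.
move=> /monicP pm sp; apply/polyP => i; rewrite coef_derivn coefC.
case: i => [|i]; last by rewrite nth_default ?mul0rn// sp addnS ltnS leq_addr.
by rewrite addn0 ffactnn -[n in p`_n]/(n.+1.-1) -sp -lead_coefE pm.
Qed.

Lemma size_prod_exp_XsubC (R : idomainType) (I : finType) (a : I -> R)
    (m : I -> nat) :
  size (\prod_j ('X - (a j)%:P) ^+ m j) = (\sum_j m j).+1.
Proof.
rewrite size_prod => [|j _]; last by rewrite expf_neq0// polyXsubC_eq0.
under eq_bigr do rewrite size_exp_XsubC -addn1.
by rewrite big_split /= sum1_card subSn ?leq_addl// addnK.
Qed.

(** * Nodes listed with multiplicity *)

(** In a sorted sequence, equal entries at positions [p] and [p + d] force all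
    the [d + 1] entries from one to the other to be equal. *)
Lemma sorted_count_run (disp : Order.disp_t) (T : orderType disp) (x0 : T)
    (s : seq T) (p d : nat) :
  sorted <=%O s -> (p + d < size s)%N -> nth x0 s p = nth x0 s (p + d) ->
  (d < count_mem (nth x0 s p) s)%N.
Proof.
move=> ss pds spd; set x := nth x0 s p.
pose u := take d.+1 (drop p s).
have su : size u = d.+1.
  by rewrite size_takel// size_drop ltn_subRL.
have ux : all (pred1 x) u.
  apply/(all_nthP x0) => i; rewrite su => id.
  rewrite nth_take// nth_drop /=.
  have le_s := @sorted_leq_nth _ _ le_trans lexx x0 s ss.
  have pid : (p + i <= p + d)%N by rewrite leq_add2l.
  have pis : (p + i < size s)%N by exact: leq_ltn_trans pds.
  have ps : (p < size s)%N by exact: leq_ltn_trans (leq_addr i p) pis.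
  rewrite eq_le; apply/andP; split; last by apply: le_s; rewrite ?inE ?leq_addr.
  by rewrite /x spd; apply: le_s; rewrite ?inE.
move: ux; rewrite all_count su => /eqP.
rewrite -(cat_take_drop p s) -(cat_take_drop d.+1 (drop p s)).
by rewrite !count_cat -/u => ->; rewrite addnA addnAC leq_addl.
Qed.

Definition node_seq (R : realType) (k : nat) (lambda : 'I_k -> R)
    (m : 'I_k -> nat) : seq R :=
  flatten [seq nseq (m j) (lambda j) | j <- enum 'I_k].

Lemma size_node_seq (R : realType) (k : nat) (lambda : 'I_k -> R)
    (m : 'I_k -> nat) :
  size (node_seq lambda m) = (\sum_(j < k) m j)%N.
Proof.
rewrite size_flatten sumnE /shape -map_comp big_map big_enum /=.
by apply: eq_bigr => j _; rewrite size_nseq.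
Qed.

Lemma count_node_seq (R : realType) (k : nat) (lambda : 'I_k -> R)
    (m : 'I_k -> nat) (x : R) :
  count_mem x (node_seq lambda m) = (\sum_(j < k | lambda j == x) m j)%N.
Proof.
rewrite count_flatten sumnE -map_comp big_map big_enum /= [RHS]big_mkcond.
by apply: eq_bigr => j _; rewrite /= count_nseq /=; case: eqP; rewrite ?mul1n.
Qed.

(** * The interpolation error *)

Theorem theorem1p5 (R : realType) (n : nat) (f : R -> R)
    (hf : n_times_differentiable n f)
    (k : nat) (hk : (0 < k)%N)
    (lambda : 'I_k -> R) (hlambda : injective lambda)
    (m : 'I_k -> nat) (hm : forall j : 'I_k, (0 < m j)%N)
    (hn : (\sum_(j < k) m j)%N = n)
    (L : {poly R}) (hL : lagrange_interpolation f lambda m L)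
    (x0 : R) :
  exists xi : R,
    convex_hull (x0 |` range lambda) xi /\
    f x0 - L.[x0] =
      f^`(n)%classic xi / (n`!)%:R * \prod_(j < k) (x0 - lambda j) ^+ m j.
Proof.
case: hL => sL hL.
have [[j x0j]|x0N] := pselect (exists j, x0 = lambda j).
  exists x0; split; first by move=> C [_]; apply; left.
  rewrite (bigD1 j)//= x0j subrr expr0n gtn_eqF// mul0r mulr0.
  by have /= -> := hL j 0%N (hm j); rewrite subrr.
pose w : {poly R} := \prod_(j < k) ('X - (lambda j)%:P) ^+ m j.
have wE x : w.[x] = \prod_(j < k) (x - lambda j) ^+ m j.
  by rewrite horner_prod; apply: eq_bigr => j _; rewrite !hornerE.
have wx0 : w.[x0] != 0.
  rewrite wE; apply/prodf_neq0 => j _; rewrite expf_neq0// subr_eq0.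
  by apply/eqP => x0j; apply: x0N; exists j.
(* The coefficient for which [g] has one more zero, at [x0]. *)
pose c := (f x0 - L.[x0]) / w.[x0].
pose g x := f x - (L + c *: w).[x].
have gE i : (i <= n)%N ->
    g^`(i)%classic = (fun x => f^`(i)%classic x - (L + c *: w)^`(i).[x]).
  exact: derive1n_sub_poly.
have gx0 : g x0 = 0.
  by rewrite /g hornerD hornerZ /c divfK//; ring.
have g_lambda j i : (i < m j)%N -> g^`(i)%classic (lambda j) = 0.
  move=> im; have mn : (m j <= n)%N by rewrite -hn (bigD1 j)//= leq_addr.
  rewrite gE ?(leq_trans (ltnW im))// derivnD derivnZ hornerD hornerZ.
  have -> : w^`(i).[lambda j] = 0.
    by rewrite /w (bigD1 j)//= mulrC derivn_root_exp.
  by rewrite -(hL j i im) derive1n_horner mulr0 addr0 subrr.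
pose s := sort <=%R (x0 :: node_seq lambda m).
have ss : size s = n.+1 by rewrite size_sort /= size_node_seq hn.
have s_sorted : sorted <=%R s by exact: sort_sorted le_total _.
have s_node p : (p <= n)%N -> (x0 |` range lambda) (nth 0 s p).
  move=> pn; have : nth 0 s p \in s by rewrite mem_nth// ss.
  rewrite mem_sort inE => /predU1P[->|]; first by left.
  by move=> /flatten_mapP[j _]; rewrite mem_nseq => /andP[_ /eqP->]; right; exists j.
have [|p pn|p d pdn spd|xi [xi01 gxi]] := @Rolle_multiplicity R n g (nth 0 s).
- exact: n_times_differentiable_sub_poly.
- by apply: (sorted_leq_nth le_trans lexx) => //; rewrite ?inE ss ltnS// ltnW.
- have pn : (p <= n)%N by exact: leq_trans (leq_addr _ _) pdn.
  have := sorted_count_run s_sorted _ spd; rewrite ss ltnS => /(_ pdn).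
  rewrite (permP (permEl (perm_sort _ _))) /= count_node_seq.
  have [->|[j _ <-]] := s_node p pn.
    (* [x0] is not a node, so it occurs once, and [d] is zero. *)
    rewrite eqxx big1 => [|j /eqP jx]; last by case: x0N; exists j.
    by case: d {pdn spd}.
  rewrite (eq_bigl (pred1 j)) => [|i]; last by rewrite (inj_eq hlambda).
  rewrite big_pred1_eq (_ : (x0 == _) = false); last first.
    by apply/eqP => x0j; apply: x0N; exists j.
  exact: g_lambda.
exists xi; split.
  exact: convex_hull_segment (s_node _ (leq0n n)) (s_node _ (leqnn n)) xi01.
have wn : w^`(n) = (n`!)%:R%:P.
  apply: derivn_monic; last by rewrite size_prod_exp_XsubC hn.
  by apply: monic_prod => j _; rewrite monic_exp// monicXsubC.
move: gxi; rewrite gE// derivnD derivnZ wn derivn_poly0 -?hn// add0r.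
rewrite hornerZ hornerC hn => /eqP; rewrite subr_eq0 => /eqP ->.
by rewrite mulfK ?pnatr_eq0 -?lt0n ?fact_gt0// -wE /c divfK.
Qed.
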